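(* Let $f,g,u_0$, the cumulative distribution functions $F,G$, the error function $E$, the grid, and the grid function $U$ generated by the finite difference scheme be as in the context. Let $T(x)=u'(x)$ be the optimal map, where $u$ is a convex solution of $$u''(x)=\frac{f(x)}{g(u'(x))}\ \text{ on }[A,B],\qquad u'(A)=C,\quad u'(B)=D.$$ Assume that $\Delta^n_jU>0$ for all $n\ge0$ and all $j=0,\dots,J$. Then for every tolerance $\sigma>0$ and every $n$, $$\max_{j=0,\dots,J}E(\nabla^n_jU,x_j)\le\sigma\quad\Longrightarrow\quad \max_{j=0,\dots,J}|T(x_j)-\nabla^n_jU|\le\frac{\sigma}{\min_{[C,D]}g}.$$
   Context: Let $[A,B],[C,D]\subset\mathbb{R}$ be bounded intervals, and let $f:[A,B]\to\mathbb{R}$ and $g:[C,D]\to\mathbb{R}$ be positive continuous functions with $\int_A^B f=\int_C^D g=1$. Let $u_0$ be a convex function on $[A,B]$ with $u_0'(A)=C$, $u_0'(B)=D$. Cumulative distribution functions: $F(x)=\int_A^x f(p)\,dp$ for $x\in[A,B]$, and $G(y)=\int_C^y g(q)\,dq$ for $y\in[C,D]$. Error function: for $\Omega\subset[A,B]$ and an increasing function $S:\Omega\to[C,D]$, $E(S,x):=|F(x)-G(S(x))|$ for $x\in\Omega$. The notation $E(\nabla^n_jU,x_j)$ refers to $\Omega=\{x_0,\dots,x_J\}$ and $S(x_j)=\nabla^n_jU$, i.e. $E(\nabla^n_jU,x_j)=|F(x_j)-G(\nabla^n_jU)|$. (That $\nabla^n_jU\in[C,D]$ and is increasing in $j$ under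 the stated hypotheses is part of what is to be shown.) Grid: $J\in\mathbb{N}$, $\Delta x=(B-A)/J$, $\Delta x^2:=(\Delta x)^2$, $x_j=A+j\Delta x$ for $j=-1,\dots,J+1$; $0=t_0<t_1<t_2<\cdots$ and $\Delta t_n=t_{n+1}-t_n$. For a grid function $\phi$, with $\phi^n_j=\phi(t_n,x_j)$, $$\nabla^n_j\phi:=\frac{\phi^n_{j+1}-\phi^n_{j-1}}{2\Delta x},\qquad \Delta^n_j\phi:=\frac{\phi^n_{j+1}+\phi^n_{j-1}-2\phi^n_j}{\Delta x^2}.$$ Finite difference scheme: $U^0_j=u_0(x_j)$ for $j=0,\dots,J$; for every $n\ge0$, $U^n_{-1}:=U^n_1-2C\Delta x$ and $U^n_{J+1}:=U^n_{J-1}+2D\Delta x$ (so that $\nabla^n_0U=C$ and $\nabla^n_JU=D$); and $$U^{n+1}_j=\left(\log(\Delta^n_jU)-\log\left(\frac{f(x_j)}{g(\nabla^n_jU)}\right)\right)\Delta t_n+U^n_j,\qquad j=0,\dots,J.$$ *)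

(* Defs.v *)
From HB Require Import structures.
From mathcomp Require Import all_boot all_order all_algebra.
From mathcomp Require Import all_classical all_reals all_analysis.
Set Implicit Arguments.
Unset Strict Implicit.
Unset Printing Implicit Defensive.
Import Order.TTheory GRing.Theory Num.Theory.
Import numFieldNormedType.Exports.
Local Open Scope classical_set_scope.
Local Open Scope ring_scope.

(* Functions on an interval are represented by total functions R -> R; only
   their values on the interval are constrained, so derivatives are taken along
   points of the interval. On `[a, b] with a < b this is the two-sided
   derivative inside and the one-sided derivative at the endpoints. *)
Definition is_deriv_on (R : realType) (I : set R) (h : R -> R) (x l : R) : Prop :=
  (fun y : R => (h y - h x) / (y - x)) @ within I (x^') --> l.

Definition cdf (R : realType) (a : R) (h : R -> R) (x : R) : R :=
  \int[@lebesgue_measure R]_(p in `[a, x]) h p.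

(* E(S, x) with s = S(x). *)
Definition cdf_error (R : realType) (A C : R) (f g : R -> R) (s x : R) : R :=
  `|cdf A f x - cdf C g s|.

(* The infimum is attained for continuous h, see min_onP. *)
Definition min_on (R : realType) (a b : R) (h : R -> R) : R :=
  inf (h @` `[a, b]).

Lemma min_onP (R : realType) (a b : R) (h : R -> R) :
  a <= b -> {within `[a, b], continuous h} ->
  (exists2 c, c \in `[a, b] & h c = min_on a b h) /\
  (forall y, y \in `[a, b] -> min_on a b h <= h y).
Proof.
move=> ab ch; have [c cab cmin] := EVT_min ab ch.
have lbc : lbound (h @` `[a, b]) (h c) by move=> _ [y yab <-]; exact: cmin.
have minE : min_on a b h = h c.
  apply/eqP; rewrite eq_le; apply/andP; split.
    by apply: ge_inf; [exists (h c) | exists c].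
  by apply: lb_le_inf => //; exists (h c); exists c.
by split; [exists c | move=> y yab; rewrite minE; exact: cmin].
Qed.

Definition mesh (R : realType) (A B : R) (J : nat) : R := (B - A) / J%:R.

(* Nodes are indexed by integers because of the ghost nodes j = -1 and J + 1. *)
Definition node (R : realType) (A B : R) (J : nat) (j : int) : R :=
  A + j%:~R * mesh A B J.

Definition grad (R : realType) (h : R) (phi : int -> R) (j : int) : R :=
  (phi (j + 1) - phi (j - 1)) / (2 * h).

Definition lapl (R : realType) (h : R) (phi : int -> R) (j : int) : R :=
  (phi (j + 1) + phi (j - 1) - 2 * phi j) / h ^+ 2.

Definition fd_scheme (R : realType) (A B C D : R) (f g u0 : R -> R)
    (J : nat) (t : nat -> R) (U : nat -> int -> R) : Prop :=
  let h := mesh A B J in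
  [/\ forall j : nat, (j <= J)%N -> U 0%N j%:Z = u0 (node A B J j%:Z),
      forall n, U n (- 1) = U n 1 - 2 * C * h,
      forall n, U n (J%:Z + 1) = U n (J%:Z - 1) + 2 * D * h &
      forall n (j : nat), (j <= J)%N ->
        U n.+1 j%:Z =
          (ln (lapl h (U n) j%:Z)
             - ln (f (node A B J j%:Z) / g (grad h (U n) j%:Z)))
            * (t n.+1 - t n) + U n j%:Z].

(* Main.v *)
(* Since Delta_j U > 0 at every node, the centered differences increase strictly
   from C (at j = 0) to D (at j = J).  The derivative T of the convex solution is
   nondecreasing, hence maps [A, B] into [C, D], and (G o T)' = g(T) T' = f gives
   G(T(x)) = F(x).  So the error at x_j is |G(T(x_j)) - G(s)|, which by the mean
   value theorem is at least min g times |T(x_j) - s|. *)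
Require Import Defs.
From HB Require Import structures.
From mathcomp Require Import all_boot all_order all_algebra.
From mathcomp Require Import ring lra.
From mathcomp Require Import all_classical all_reals all_analysis.
Import Order.TTheory GRing.Theory Num.Theory.
Import numFieldNormedType.Exports.
Local Open Scope classical_set_scope.
Local Open Scope ring_scope.

(** * Derivatives relative to a set *)

Lemma is_deriv_on_cvg_continuous {R : realType} {I : set R} {h : R -> R} {x l : R} :
  is_deriv_on I h x l -> h @ within I (nbhs x) --> h x.
Proof.
move=> dh; have xN : (fun y : R => y) @ within I x^' --> x.
  by apply: cvg_within_filter; apply: cvg_within_filter; exact: cvg_id.
have hN : h @ within I x^' --> h x.
  (* This identity also holds at [y = x], where the second summand vanishes; in the limit the factor
     [y - x] removes the slope. *)
  have -> : h = (fun y => h x + (h y - h x) / (y - x) * (y - x)).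
    apply/funext => y; have [->|yx] := eqVneq y x; first by rewrite !subrr mulr0 addr0.
    by rewrite divfK ?subr_eq0// addrC subrK.
  rewrite [X in _ --> X](_ : _ = h x + l * (x - x)); last by rewrite !subrr !mulr0.
  by apply: cvgD; [exact: cvg_cst | apply: cvgM => //; apply: cvgB => //; exact: cvg_cst].
apply/cvgrPdist_lt => e e0; move/cvgrPdist_lt : hN => /(_ _ e0).
rewrite !near_withinE; apply: filterS => y hy Iy.
have [->|yx] := eqVneq y x; first by rewrite subrr normr0.
exact: hy.
Qed.

Lemma is_deriv_on_continuous {R : realType} {I : set R} {h dh : R -> R} :
  (forall x, I x -> is_deriv_on I h x (dh x)) -> {within I, continuous h}.
Proof.
move=> d; apply/subspace_continuousP => x Ix.
exact: is_deriv_on_cvg_continuous (d _ Ix).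
Qed.

(** Bridge to the mean value theorem and the chain rule, which speak of [is_derive]. Near an
    interior point the restriction to [I] is void, and [y = k + x] turns the difference quotient
    into one in the increment [k]. *)
Lemma is_deriv_on_interior {R : realType} {I : set R} {h : R -> R} {x l : R} :
  nbhs x I -> is_deriv_on I h x l -> is_derive x 1 h l.
Proof.
move=> xI dh.
have dh' : (fun y : R => (h y - h x) / (y - x)) @ x^' --> l.
  apply: cvg_trans dh; apply: cvg_app => A; rewrite /within/= => wA.
  by apply: filterS2 xI wA => y Iy; rewrite /= => wA yx; exact: wA.
have sh : (fun k : R => k + x) @ 0^' --> x^'.
  move=> A [e /= e0 eA]; exists e => //= k ke k0; apply: eA; last first.
    by rewrite -subr_eq0 addrK.
  by move: ke; rewrite /ball_/= sub0r normrN opprD addrCA subrr addr0 normrN.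
have dk : (fun k : R => k^-1 *: ((h \o shift x) (k *: (1 : R)) - h x)) @ 0^' --> l.
  have -> : (fun k : R => k^-1 *: ((h \o shift x) (k *: (1 : R)) - h x)) =
      (fun y => (h y - h x) / (y - x)) \o (fun k => k + x).
    by apply/funext => k /=; rewrite addrK /GRing.scale/= mulr1 mulrC.
  exact: cvg_comp sh dh'.
by split; [apply: cvgP dk | apply: cvg_lim dk].
Qed.

(** * Convexity and monotonicity of the derivative *)

Lemma convex_slope_le {R : realType} {I : set R} {u : R -> R} {x y z : R} :
  @convex_function R R^o I u -> I x -> I z -> x < y -> y < z ->
  (u y - u x) / (y - x) <= (u z - u x) / (z - x) <= (u z - u y) / (z - y).
Proof.
move=> cu Ix Iz xy yz; have xz := lt_trans xy yz.
(* [(z - y) / (z - x)] is the weight of [x] when [y] is written as a convex combination of [x] and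
   [z]. Both slope inequalities are rearrangements of [e] below. *)
have t0 : 0 <= (z - y) / (z - x) by rewrite divr_ge0// subr_ge0 ltW.
have t1 : (z - y) / (z - x) <= 1.
  by rewrite ler_pdivrMr ?subr_gt0// mul1r lerD2l lerN2 ltW.
have := cu (Itv01 t0 t1) x z (mem_set Ix) (mem_set Iz).
have /eqP zx0 : z - x != 0 by rewrite subr_eq0 gt_eqF.
have -> : conv (Itv01 t0 t1) (x : convex_lmodType R^o) z = y.
  rewrite -[LHS]/((z - y) / (z - x) * x + unstable.onem ((z - y) / (z - x)) * z).
  by rewrite /unstable.onem; field; exact/eqP.
rewrite convRE /= /unstable.onem => uy.
have e : u y * (z - x) <= (z - y) * u x + (y - x) * u z.
  rewrite -ler_pdivlMr ?subr_gt0//; apply: (le_trans uy).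
  by rewrite le_eqVlt; apply/orP; left; apply/eqP; field; apply/eqP.
by apply/andP; split; rewrite ler_pdivrMr ?subr_gt0// mulrAC ler_pdivlMr ?subr_gt0//; nra.
Qed.

Lemma is_deriv_on_right {R : realType} {I : set R} {h : R -> R} {x l b : R} :
  x < b -> `[x, b] `<=` I -> is_deriv_on I h x l ->
  (fun y => (h y - h x) / (y - x)) @ x^'+ --> l.
Proof.
move=> xb xbI; apply: cvg_trans; apply: cvg_app => A wA.
have {}wA : nbhs x (fun y => y != x -> I y -> A y) := wA.
apply: filterS2 wA (lt_nbhsl xb) => y /= yA yb xy; apply: yA; first by rewrite gt_eqF.
by apply: xbI; rewrite /= in_itv/= (ltW xy) (ltW yb).
Qed.

Lemma is_deriv_on_left {R : realType} {I : set R} {h : R -> R} {x l a : R} :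
  a < x -> `[a, x] `<=` I -> is_deriv_on I h x l ->
  (fun y => (h y - h x) / (y - x)) @ x^'- --> l.
Proof.
move=> ax axI; apply: cvg_trans; apply: cvg_app => A wA.
have {}wA : nbhs x (fun y => y != x -> I y -> A y) := wA.
apply: filterS2 wA (lt_nbhsr ax) => y /= yA ay yx; apply: yA; first by rewrite lt_eqF.
by apply: axI; rewrite /= in_itv/= (ltW yx) (ltW ay).
Qed.

(** The slope of the chord over [[x, y]] separates the two derivatives: it bounds the right
    quotients at [x] from above and the left quotients at [y] from below. One-sided limits make this
    work at endpoints of the interval too. *)
Lemma convex_deriv_le {R : realType} {I : set R} {u : R -> R} {x y l m : R} :
  @convex_function R R^o I u -> x < y -> `[x, y] `<=` I ->
  is_deriv_on I u x l -> is_deriv_on I u y m -> l <= m.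
Proof.
move=> cu xy xyI dx dy.
have Ix : I x by apply: xyI; rewrite /= in_itv/= lexx ltW.
have Iy : I y by apply: xyI; rewrite /= in_itv/= lexx ltW.
apply: (@le_trans _ _ ((u y - u x) / (y - x))).
  apply: (@cvgr_to_le _ x^'+ _ _ _ _ _ (is_deriv_on_right xy xyI dx)).
  near=> z.
  have xz : x < z by near: z; exact: nbhs_right_gt.
  have zy : z < y by near: z; exact: nbhs_right_lt.
  by have /andP[] := convex_slope_le cu Ix Iy xz zy.
apply: (@cvgr_to_ge _ y^'- _ _ _ _ _ (is_deriv_on_left xy xyI dy)).
near=> z.
have xz : x < z by near: z; exact: nbhs_left_gt.
have zy : z < y by near: z; exact: nbhs_left_lt.
rewrite -(opprB (u y) (u z)) -(opprB y z) invrN mulrNN.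
by have /andP[] := convex_slope_le cu Ix Iy xz zy.
Unshelve. all: by end_near. Qed.

(** * Cumulative distribution functions and transport of mass *)

(* [Defs.cdf] is qualified because the probability library shadows [cdf]. *)
Lemma cdf_continuous {R : realType} {a b : R} {h : R -> R} :
  a <= b -> {within `[a, b], continuous h} ->
  {within `[a, b], continuous (Defs.cdf a h)}.
Proof.
move=> ab ch; apply: parameterized_integral_continuous => //.
by apply: continuous_compact_integrable => //; exact: segment_compact.
Qed.

Lemma cdf_is_derive {R : realType} {a b : R} {h : R -> R} {x : R} :
  {within `[a, b], continuous h} -> x \in `]a, b[ ->
  is_derive x 1 (Defs.cdf a h) (h x).
Proof.
move=> ch xab; have := xab; rewrite in_itv/= => /andP[ax xb].
have ih : lebesgue_measure.-integrable `[a, b] (EFin \o h).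
  by apply: continuous_compact_integrable => //; exact: segment_compact.
have hx : {for x, continuous h}.
  by have [/(_ _ xab)] := (continuous_within_itvP h (lt_trans ax xb)).1 ch.
have [dh <-] := continuous_FTC1_closed xb ih ax hx.
by rewrite derive1E; exact: derivableP.
Qed.

(** Meant for G o T: G is known to be continuous only relative to [[C, D]], so T has to map into
    that interval. *)
Lemma within_continuous_comp_within {U V W : topologicalType}
  {A : set U} {B : set V} {f : U -> V} {g : V -> W} :
  (forall x, A x -> B (f x)) -> {within A, continuous f} ->
  {within B, continuous g} -> {within A, continuous (g \o f)}.
Proof.
move=> AB /subspace_continuousP cf /subspace_continuousP cg.
apply/subspace_continuousP => x Ax.
apply: cvg_comp (cg _ (AB _ Ax)) => S wS.
have := cf _ Ax _ wS; rewrite /= /within/= /nbhs/=.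
by apply: filterS => y /= yS Ay; apply: yS => //; exact: AB.
Qed.

Lemma min_on_gt0 {R : realType} {a b : R} {h : R -> R} :
  a <= b -> {within `[a, b], continuous h} ->
  (forall y, y \in `[a, b] -> 0 < h y) -> 0 < min_on a b h.
Proof. by move=> ab ch hp; have [[c cab <-] _] := min_onP ab ch; exact: hp. Qed.

(** Converts an error in mass into an error in position: the mean value theorem yields a density
    value [h c] as factor, and [h c] is at least the minimum. *)
Lemma cdf_dist_ge {R : realType} {a b : R} {h : R -> R} {x y : R} :
  {within `[a, b], continuous h} -> x \in `[a, b] -> y \in `[a, b] ->
  min_on a b h * `|x - y| <= `|Defs.cdf a h x - Defs.cdf a h y|.
Proof.
move=> ch; wlog xy : x y / x <= y => [W xab yab|].
  have [/W|/ltW/W] := leP x y; first exact.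
  by rewrite distrC (distrC (Defs.cdf a h y)); exact.
move=> /[!in_itv]/= /andP[ax xb] /andP[ay yb].
have [c /[!in_itv]/= /andP[xc cy] e] : exists2 c, c \in `[x, y] &
    Defs.cdf a h y - Defs.cdf a h x = h c * (y - x).
  (* This form of the theorem allows [x = y] and asks for derivatives in the open interval only. *)
  apply: MVT_segment => //.
    move=> z /[!in_itv]/= /andP[xz zy]; apply: cdf_is_derive ch _.
    by rewrite in_itv/= (le_lt_trans ax xz) (lt_le_trans zy yb).
  apply: continuous_subspaceW (cdf_continuous (le_trans ax xb) ch) => z /=.
  by rewrite !in_itv/= => /andP[xz zy]; rewrite (le_trans ax xz) (le_trans zy yb).
rewrite (distrC x) (distrC (Defs.cdf a h x)) e normrM (ger0_norm (_ : 0 <= y - x)) ?subr_ge0//.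
rewrite ler_wpM2r ?subr_ge0//; apply: le_trans (ler_norm _).
apply: (min_onP (le_trans ax xb) ch).2.
by rewrite in_itv/= (le_trans ax xc) (le_trans cy yb).
Qed.

(* T cannot take the value C or D at an interior point: it is nondecreasing and
   the mean value theorem makes it strictly increasing.  Hence g o T is
   continuous in the interior whatever the values of g outside `[C, D] are. *)
Lemma cdf_transport {R : realType} {A B C D : R} {f g T : R -> R} {x : R} :
  {within `[A, B], continuous f} -> {within `[C, D], continuous g} ->
  (forall x, x \in `[A, B] -> 0 < f x) -> (forall y, y \in `[C, D] -> 0 < g y) ->
  (forall x, x \in `[A, B] -> T x \in `[C, D]) -> T A = C -> T B = D ->
  (forall x, x \in `[A, B] -> is_deriv_on `[A, B] T x (f x / g (T x))) ->
  x \in `[A, B] -> Defs.cdf C g (T x) = Defs.cdf A f x.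
Proof.
move=> cf cg f0 g0 TCD TA TB dT; rewrite in_itv/= => /andP[Ax xB].
have cT : {within `[A, B], continuous T} := is_deriv_on_continuous dT.
have CD : C <= D.
  have := TCD A; rewrite !in_itv/= lexx (le_trans Ax xB) => /(_ isT)/andP[].
  exact: le_trans.
have sub (a b : R) : A <= a -> b <= B -> `[a, b] `<=` `[A, B].
  move=> Aa bB z /=; rewrite !in_itv/= => /andP[az zb].
  by rewrite (le_trans Aa az) (le_trans zb bB).
have dTi (z : R) : z \in `]A, B[ -> is_derive z 1 T (f z / g (T z)).
  move=> zAB; have zI : z \in `[A, B] by exact: subset_itv_oo_cc.
  apply: is_deriv_on_interior (dT _ zI).
  by apply: filterS (near_in_itvoo zAB) => w; exact: subset_itv_oo_cc.
have Tlt (a b : R) : A <= a -> a < b -> b <= B -> T a < T b.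
  move=> Aa ab bB; rewrite -subr_gt0.
  have dTab z : z \in `]a, b[ -> is_derive z 1 T (f z / g (T z)).
    rewrite in_itv/= => /andP[az zb].
    by apply: dTi; rewrite in_itv/= (le_lt_trans Aa az) (lt_le_trans zb bB).
  have [c cab ->] := MVT ab dTab (continuous_subspaceW (sub _ _ Aa bB) cT).
  have cAB : c \in `[A, B] by apply: (sub a b) => //; exact: subset_itv_oo_cc.
  by rewrite mulr_gt0 ?subr_gt0// divr_gt0 ?f0 ?g0 ?TCD.
(* H vanishes at A, where both integrals run over a single point, and its derivative g(T) T' - f is
   zero on []A, x[]; so H x = 0. *)
pose H z := Defs.cdf C g (T z) - Defs.cdf A f z.
have cH : {within `[A, B], continuous H}.
  have cGT := within_continuous_comp_within (B := `[C, D]) TCD cT (cdf_continuous CD cg).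
  have cF := cdf_continuous (le_trans Ax xB) cf.
  by move=> z; apply: cvgB; [exact: cGT | exact: cF].
have dH z : z \in `]A, x[ -> is_derive z 1 H 0.
  rewrite in_itv/= => /andP[Az zx]; have zB := lt_le_trans zx xB.
  have zI : z \in `]A, B[ by rewrite in_itv/= Az zB.
  have TzI : T z \in `]C, D[ by rewrite in_itv/= -TA -TB !Tlt// ltW.
  have gTz : g (T z) != 0 by rewrite gt_eqF// g0// TCD// in_itv/= !ltW.
  have dGT := is_derive1_comp (cdf_is_derive cg TzI) (dTi _ zI).
  have dF := cdf_is_derive cf zI.
  by have := is_deriveB dGT dF; rewrite mulrC divfK// subrr; exact.
have cHx := continuous_subspaceW (sub _ _ (lexx A) xB) cH.
have [c _] := MVT_segment (df := fun=> 0) Ax dH cHx.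
rewrite mul0r /H TA /Defs.cdf !set_itv1 !Rintegral_set1 subrr subr0.
by move/eqP; rewrite subr_eq0 => /eqP.
Qed.

(** * Centered differences on the grid *)

(** A discrete fundamental theorem of calculus: the right-hand side is the trapezoidal rule for the
    second difference over one cell. *)
Lemma grad_succ {R : realType} {h : R} (phi : int -> R) (j : int) : h != 0 ->
  grad h phi (j + 1) - grad h phi j = h / 2 * (lapl h phi j + lapl h phi (j + 1)).
Proof. by move=> h0; rewrite /grad /lapl addrK; field. Qed.

Lemma grad_increasing {R : realType} {h : R} {phi : int -> R} {J : nat} :
  0 < h -> (forall j : nat, (j <= J)%N -> 0 < lapl h phi j%:Z) ->
  forall i j : nat, (i < j)%N -> (j <= J)%N -> grad h phi i%:Z < grad h phi j%:Z.
Proof.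
move=> h0 lap i j; elim: j => // j IH; rewrite ltnS leq_eqVlt => ij jJ.
have step : grad h phi j%:Z < grad h phi j.+1%:Z.
  have jS : j.+1%:Z = j%:Z + 1 by rewrite -addn1 PoszD.
  have lapS := lap _ jJ; rewrite jS in lapS *.
  by rewrite -subr_gt0 grad_succ ?gt_eqF// mulr_gt0 ?divr_gt0 ?addr_gt0// lap// ltnW.
case/orP: ij => [/eqP->|ij]; first exact: step.
by apply: lt_trans step; apply: IH => //; exact: ltnW.
Qed.

Theorem theorem3p1 (R : realType) (A B C D : R) (f g u0 : R -> R)
  (hAB : A < B) (hCD : C < D)
  (hfc : {within `[A, B], continuous f})
  (hgc : {within `[C, D], continuous g})
  (hfpos : forall x, x \in `[A, B] -> 0 < f x)
  (hgpos : forall y, y \in `[C, D] -> 0 < g y)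
  (hfint : \int[@lebesgue_measure R]_(p in `[A, B]) f p = 1)
  (hgint : \int[@lebesgue_measure R]_(q in `[C, D]) g q = 1)
  (* initial datum *)
  (hu0cvx : @convex_function R R^o `[A, B] u0)
  (hu0A : is_deriv_on `[A, B] u0 A C)
  (hu0B : is_deriv_on `[A, B] u0 B D)
  (* grid and scheme *)
  (J : nat) (hJ : (0 < J)%N)
  (t : nat -> R) (ht0 : t 0%N = 0) (htincr : forall n, t n < t n.+1)
  (U : nat -> int -> R) (hU : fd_scheme A B C D f g u0 J t U)
  (* u is a convex solution of the boundary value problem and T = u' *)
  (u T : R -> R)
  (hucvx : @convex_function R R^o `[A, B] u)
  (hT : forall x, x \in `[A, B] -> is_deriv_on `[A, B] u x (T x))
  (hMA : forall x, x \in `[A, B] -> is_deriv_on `[A, B] T x (f x / g (T x)))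
  (hTA : T A = C) (hTB : T B = D)
  (hlapl : forall n (j : nat), (j <= J)%N -> 0 < lapl (mesh A B J) (U n) j%:Z) :
  forall n,
    (* j |-> grad j is an increasing map into [C, D], so that the error
       function E is defined on it *)
    [/\ forall j : nat, (j <= J)%N -> grad (mesh A B J) (U n) j%:Z \in `[C, D],
        forall i j : nat, (i < j)%N -> (j <= J)%N ->
          grad (mesh A B J) (U n) i%:Z < grad (mesh A B J) (U n) j%:Z &
        forall sigma : R, 0 < sigma ->
          \big[Num.max/0]_(j < J.+1)
             cdf_error A C f g (grad (mesh A B J) (U n) j%:Z) (node A B J j%:Z)
            <= sigma ->
          \big[Num.max/0]_(j < J.+1)
             `|T (node A B J j%:Z) - grad (mesh A B J) (U n) j%:Z|
            <= sigma / min_on C D g].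
Proof.
move=> n; pose h := mesh A B J.
have h0 : 0 < h by rewrite divr_gt0 ?subr_gt0 ?ltr0n.
have [_ ghostA ghostB _] := hU.
(* The ghost values at -1 and J + 1 make the boundary gradients exactly C and D. *)
have gradA : grad h (U n) 0%:Z = C.
  by rewrite /grad add0r sub0r ghostA -/h; field; rewrite gt_eqF.
have gradB : grad h (U n) J%:Z = D.
  by rewrite /grad ghostB -/h; field; rewrite gt_eqF.
have incr := grad_increasing h0 (hlapl n).
have gradCD (j : nat) : (j <= J)%N -> grad h (U n) j%:Z \in `[C, D].
  (* With C and D rewritten as the gradients at 0 and J, membership becomes monotonicity in [j]. *)
  move=> jJ; rewrite in_itv/= -{1}gradA -gradB; apply/andP; split.
    by case: j jJ => // j jJ; exact/ltW/incr.
  by move: (jJ); rewrite leq_eqVlt => /orP[/eqP-> //|jltJ]; exact/ltW/incr.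
split=> // sigma sigma0 /bigmax_leP[_ err].
have m0 := min_on_gt0 (ltW hCD) hgc hgpos.
have AI : A \in `[A, B] by rewrite in_itv/= lexx ltW.
have BI : B \in `[A, B] by rewrite in_itv/= lexx ltW.
have Tle (x y : R) : x \in `[A, B] -> y \in `[A, B] -> x < y -> T x <= T y.
  move=> xI yI xy; apply: (convex_deriv_le hucvx xy _ (hT _ xI) (hT _ yI)).
  move: xI yI; rewrite !in_itv/= => /andP[Ax _] /andP[_ yB] z /=.
  by rewrite !in_itv/= => /andP[xz zy]; rewrite (le_trans Ax xz) (le_trans zy yB).
have TCD (x : R) : x \in `[A, B] -> T x \in `[C, D].
  move=> xI; have := xI; rewrite !in_itv/= -hTA -hTB !le_eqVlt.
  move=> /andP[Ax xB]; rewrite -!le_eqVlt; apply/andP; split.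
    by case/predU1P: Ax => [->//|Ax]; exact: Tle.
  by case/predU1P: xB => [->//|xB]; exact: Tle.
(* The maximum starts from 0, so the bound itself must also be shown nonnegative. *)
apply/bigmax_leP; split=> [|j _]; first by rewrite divr_ge0 ?ltW.
have jJ : (j <= J)%N by rewrite -ltnS.
have xI : node A B J j%:Z \in `[A, B].
  rewrite in_itv/= /node lerDl mulr_ge0 ?(ltW h0)//= addrC -lerBrDr.
  rewrite /mesh mulrCA ler_piMr ?subr_ge0 ?(ltW hAB)//.
  by rewrite ler_pdivrMr ?ltr0n// mul1r ler_nat.
rewrite ler_pdivlMr// mulrC; apply: le_trans (cdf_dist_ge hgc (TCD _ xI) (gradCD _ jJ)) _.
(* Replacing G(T(x_j)) by F(x_j) turns the difference of masses into the error at x_j. *)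
by rewrite (cdf_transport hfc hgc hfpos hgpos TCD hTA hTB hMA xI); exact: err.
Qed.
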